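(* For every instance of the restricted assignment problem, the configuration LP has integrality gap at most $33/17$. That is, $OPT\le\frac{33}{17}\,OPT_{LP}$: there is a schedule whose makespan is at most $\frac{33}{17}\,OPT_{LP}$.
   Context: Restricted assignment problem: we are given a finite set $\mathcal{J}$ of jobs and a finite set $\mathcal{M}$ of machines. Each job $j$ has a size $p_j\ge 0$ and a nonempty set $\Gamma(j)\subseteq\mathcal{M}$ of machines it may be assigned to. Equivalently, $p_{ij}\in\{p_j,\infty\}$. A schedule is a map $\sigma:\mathcal{J}\to\mathcal{M}$ with $\sigma(j)\in\Gamma(j)$. Its makespan is $\max_i\sum_{j\in\sigma^{-1}(i)}p_j$, and $OPT$ is the minimum makespan over all schedules. For $T\ge 0$ and $i\in\mathcal{M}$, let $\mathcal{C}(i,T)$ be the set of configurations for $i$. These are the sets $C\subseteq\{j: i\in\Gamma(j)\}$ with $\sum_{j\in C}p_j\le T$. The configuration LP with target $T$ has a variable $x_{i,C}\ge 0$ for each $i\in\mathcal{M}$ and each $C\in\mathcal{C}(i,T)$, subject to the constraints $\sum_{C\in\mathcal{C}(i,T)}x_{i,C}\le 1$ for each $i\in\mathcal{M}$, and $\sum_{i\in\mathcal{M}}\sum_{C\in\mathcal{C}(i,T),\,C\ni j}x_{i,C}\ge 1$ for each $j\in\mathcal{J}$. $OPT_{LP}$ denotes the minimum $T$ for which this LP is feasible. *)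

(* Defs.v *)
From mathcomp Require Import all_boot all_order all_algebra.
Set Implicit Arguments. Unset Strict Implicit. Unset Printing Implicit Defensive.
Import Order.TTheory GRing.Theory Num.Theory.
Local Open Scope ring_scope.

Section RA.
Variables (R : realFieldType) (J M : finType) (p : J -> R) (Gamma : J -> {set M}).

Definition is_config (T : R) (i : M) (C : {set J}) : bool :=
  (C \subset [set j | i \in Gamma j]) && (\sum_(j in C) p j <= T).

(* feasibility of the configuration LP with target T; x i C is only
   relevant for configurations C of i (other entries never appear) *)
Definition configLP_feasible (T : R) : Prop :=
  exists x : M -> {set J} -> R,
    (forall i C, is_config T i C -> 0 <= x i C) /\
    (forall i, \sum_(C | is_config T i C) x i C <= 1) /\
    (forall j, 1 <= \sum_(i : M) \sum_(C | is_config T i C && (j \in C)) x i C).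

Definition is_schedule (sigma : J -> M) : Prop := forall j, sigma j \in Gamma j.

Definition load (sigma : J -> M) (i : M) : R := \sum_(j | sigma j == i) p j.
End RA.

(* Main.v *)
(* Local search after Svensson and Jansen-Rohwedder, with capacity T + q for any
   q in [5T/6, T]; the theorem is the case q = 16T/17.

   A partial schedule is extended by one job j0.  If j0 does not fit, one builds
   a list of blockers (j, i): an active job j would like to move to machine i,
   which is too full; this activates some of the jobs on i and closes i to
   further moves of some jobs.  As soon as some blocker (j, i) has room, j is
   moved and the list is cut after the blocker that activated j.  The
   list of blocker values then increases lexicographically, so the search ends,
   either with j0 scheduled or with a list that cannot be prolonged.

   In the latter case give each active job j the value min(p_j, q), each fully
   closed machine the budget T, and any other machine the value of its active
   jobs.  These budgets pay for every configuration, but the unscheduled job j0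
   makes the total value exceed the total budget, which contradicts LP duality. *)

Require Import Defs.
From mathcomp Require Import all_boot all_order all_algebra.
From mathcomp Require Import lra zify.
Import Order.TTheory GRing.Theory Num.Theory.
Local Open Scope ring_scope.

(** * Ranking of the jobs and lexicographic codes *)

Lemma sorting_rank (R : realFieldType) (J : finType) (p : J -> R) :
  exists rho : J -> nat,
    [/\ injective rho, forall x, (rho x < #|J|)%N
      & forall x y, (rho x <= rho y)%N -> p x <= p y].
Proof.
pose r := relpre p <=%R; pose s := sort r (enum J).
have r_tot : total r by move=> x y; exact: le_total.
have r_tr : transitive r by move=> y x z; exact: le_trans.
have s_in x : x \in s by rewrite mem_sort mem_enum.
exists (index^~ s); split.
- by move=> x y; exact: index_inj.
- by move=> x; rewrite cardE -(size_sort r) index_mem.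
- move=> x y; rewrite leq_eqVlt => /orP[/eqP/index_inj-> //|lt_xy].
  have := sorted_ltn_nth r_tr x (sort_sorted r_tot (enum J)).
  move=> /(_ (index x s) (index y s)); rewrite !inE !index_mem !s_in.
  by move=> /(_ isT isT lt_xy); rewrite !nth_index.
Qed.

Fixpoint lex_lt (s t : seq nat) : bool :=
  match s, t with
  | [::], _ :: _ => true
  | a :: s', b :: t' => (a < b)%N || ((a == b) && lex_lt s' t')
  | _, [::] => false
  end.

(** A list with entries at most [V] becomes [N] digits in base [V + 2]. Entries are shifted by one,
    so the digit 0 marks the end of the list and a proper prefix gets a smaller code. *)
Fixpoint lex_code (V N : nat) (s : seq nat) : nat :=
  match N, s with
  | N'.+1, a :: s' => (a.+1 * V.+2 ^ N' + lex_code V N' s')%N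
  | _, _ => 0
  end.

Lemma lex_code_lt V N s : all (leq^~ V) s -> (lex_code V N s < V.+2 ^ N)%N.
Proof.
elim: N s => [|N IH] [|a s] //=; first by rewrite expn_gt0.
case/andP=> aV /IH lt_s; rewrite expnS [in ltnRHS]mulSn addnC -addSn leq_add //.
by rewrite leq_mul2r ltnS aV orbT.
Qed.

Lemma lex_code_mono V N s t : all (leq^~ V) s -> all (leq^~ V) t ->
  (size t <= N)%N -> lex_lt s t -> (lex_code V N s < lex_code V N t)%N.
Proof.
elim: N s t => [|N IH] [|a s] [|b t] //=.
  by move=> _ _ _ _; rewrite addn_gt0 muln_gt0 expn_gt0.
case/andP=> aV sV /andP[bV tV] tN /orP[lt_ab|/andP[/eqP<- lt_st]]; last first.
  by rewrite ltn_add2l IH.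
apply: (@leq_trans (a.+2 * V.+2 ^ N)); last first.
  by apply: leq_trans (leq_addr _ _); rewrite leq_mul2r ltnS lt_ab orbT.
by rewrite [X in (_ < X)%N]mulSn addnC ltn_add2r lex_code_lt.
Qed.

Section Stages.
Local Open Scope nat_scope.
Implicit Types n a b r : nat.

(** Within a block of length [3(n + 1)], the kinds [All], [Least] and [Pending] occupy consecutive
    intervals of length [n + 1]. *)
Lemma stage_all_least n a r : n - a < n.+1 + r.
Proof. by lia. Qed.

Lemma stage_all_pending n a b : n - a < n.+1 * 2 + b.
Proof. by lia. Qed.

Lemma stage_least_pending n r b : r < n -> n.+1 + r < n.+1 * 2 + b.
Proof. by lia. Qed.

Lemma ltn_subS n a b : a < b -> b <= n -> n - b < n - a.
Proof. by lia. Qed.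

End Stages.

(** * Blockers, their kinds and their values *)

Section LocalSearch.
Variables (R : realFieldType) (J M : finType) (p : J -> R) (Gamma : J -> {set M}).
Variables (T q : R) (rho : J -> nat) (n : nat).
Hypothesis card_le : forall X : {set J}, (#|X| <= n)%N.
Hypothesis p_ge0 : forall j, 0 <= p j.
Hypothesis rho_inj : injective rho.
Hypothesis rho_lt : forall x, (rho x < n)%N.
Hypothesis rho_le : forall x y, (rho x <= rho y)%N -> p x <= p y.

Implicit Types (sigma : J -> option M) (K : {set M}) (X Y : {set J}).
Implicit Types (i : M) (x y g : J) (e : J * M).

Definition wt X : R := \sum_(x in X) p x.
Definition small x := p x *+ 2 <= T.
Definition on sigma i := [set x | sigma x == Some i].
(* [K] is the set of fully closed machines: stuck jobs have nowhere else to go. *)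
Definition stuck K sigma i :=
  [set x in on sigma i | small x && (Gamma x \subset i |: K)].
Definition big sigma i := [set x in on sigma i | ~~ small x].
Definition least sigma i : option J :=
  [pick g in big sigma i | [forall h in big sigma i, rho g <= rho h]%N].

Definition reassign sigma y i : J -> option M :=
  fun x => if x == y then Some i else sigma x.

(* Ways a blocker [(j, i)] obstructs: [Small] if [j] is small; otherwise, whether
   the stuck jobs alone keep [j] out ([Tight]), together with the least big job
   of [i] ([Least]), together with all its big jobs ([All]), or only together
   with small jobs that might still move elsewhere ([Pending]). *)
Variant kind := Small | Tight | Least of J | All | Pending.

Definition kind_of K sigma e : kind :=
  let: (j, i) := e in
  let S := stuck K sigma i in
  let rest := if T + q < wt S + wt (big sigma i) + p j then All else Pending in
  if small j then Small
  else if T + q < wt S + p j then Tight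
  else if least sigma i is Some g then
    if T + q < wt S + p g + p j then Least g else rest
  else rest.

Definition full k := match k with Small | Pending => true | _ => false end.

Definition activated K sigma e : {set J} :=
  let S := stuck K sigma e.2 in
  match kind_of K sigma e with
  | Small | Pending => on sigma e.2
  | Tight => S
  | Least g => g |: S
  | All => big sigma e.2 :|: S
  end.

(** A closed job is either one whose arrival could spoil the kind or the value of the blocker, or
    one at least as large as [e.1]. In particular [e.1] itself is closed out. *)
Definition closes K sigma e x : bool :=
  match kind_of K sigma e with
  | Small | Pending => true
  | Tight => ~~ small x && (p e.1 <= p x)
  | Least g => ~~ small x && ((p e.1 <= p x) || (rho x <= rho g)%N)
  | All => ~~ small x
  end.

(* Grows when an activated job leaves: either fewer jobs are stuck, or the kind
   advances in the order [All], [Least], [Pending], or the last term grows. *)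
Definition value K sigma e : nat :=
  let base := ((n - #|stuck K sigma e.2|) * (n.+1 * 3))%N in
  match kind_of K sigma e with
  | Small => (n - #|on sigma e.2|)%N
  | Tight => base
  | All => (base + (n - #|big sigma e.2|))%N
  | Least g => (base + (n.+1 + rho g))%N
  | Pending => (base + (n.+1 * 2 + (n - #|on sigma e.2|)))%N
  end.

Definition max_value := (n.+1 * (n.+1 * 3))%N.

Lemma value_le K sigma e : (value K sigma e <= max_value)%N.
Proof.
rewrite /value /max_value.
have B : ((n - #|stuck K sigma e.2|) * (n.+1 * 3) <=
          n * (n.+1 * 3))%N by rewrite leq_mul2r leq_subr orbT.
rewrite mulSn; case: kind_of => [||g||]; try lia.
by have := rho_lt g; lia.
Qed.

Lemma wt_subset X Y : X \subset Y -> wt X <= wt Y.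
Proof.
move=> sXY; rewrite /wt [leRHS](big_setID X) /= (setIidPr sXY) lerDl.
exact: sumr_ge0.
Qed.

Lemma wt_mem X x : x \in X -> p x <= wt X.
Proof.
move=> xX; have := @wt_subset [set x] X; rewrite sub1set => /(_ xX).
by rewrite {1}/wt big_set1.
Qed.

Lemma leastP sigma i g :
  reflect (g \in big sigma i /\ forall h, h \in big sigma i -> (rho g <= rho h)%N)
          (least sigma i == Some g).
Proof.
apply: (iffP eqP); rewrite /least.
  case: pickP => [g' /andP[g'B /forall_inP g'_min] [<-] //|//].
case=> gB g_min; case: pickP => [g' /andP[g'B /forall_inP g'_min]|/(_ g)].
  by congr Some; apply: rho_inj; apply/eqP; rewrite eqn_leq g_min // g'_min.
by rewrite gB /= => /negP[]; apply/forall_inP.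
Qed.

Lemma least_none sigma i : least sigma i = None -> big sigma i = set0.
Proof.
rewrite /least; case: pickP => // nomin _; apply/eqP; rewrite -[_ == _]negbK.
apply/negP => /set0Pn[x xB].
case: (arg_minnP rho xB) => g gB g_min.
by have /negP[] := negbT (nomin g); apply/andP; split=> //; apply/forall_inP.
Qed.

Lemma stuck_on K sigma i : stuck K sigma i \subset on sigma i.
Proof. by apply/subsetP => x; rewrite inE => /andP[]. Qed.

Lemma big_on sigma i : big sigma i \subset on sigma i.
Proof. by apply/subsetP => x; rewrite inE => /andP[]. Qed.

Lemma kind_leastE K sigma e g : kind_of K sigma e = Least g ->
  [/\ least sigma e.2 = Some g, ~~ small e.1 &
      T + q < wt (stuck K sigma e.2) + p g + p e.1].
Proof.
case: e => j i /=; case: (boolP (small j)) => // _; case: ifP => // _.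
case: least => [h|]; last by case: ifP.
by case: ifP => [lt_h [<-]|_] //; case: ifP.
Qed.

Lemma kind_smallE K sigma e : kind_of K sigma e = Small -> small e.1.
Proof.
case: e => j i /=; case: ifP => // _; case: ifP => // _.
by case: least => [g|]; [case: ifP => // _|]; case: ifP.
Qed.

Lemma activated_on K sigma e : activated K sigma e \subset on sigma e.2.
Proof.
rewrite /activated; case kE: (kind_of K sigma e) => [||g||] //.
- exact: stuck_on.
- case/kind_leastE: kE => /eqP/leastP[gB _] _ _.
  by rewrite subUset stuck_on sub1set (subsetP (big_on _ _)).
- by rewrite subUset big_on stuck_on.
Qed.

Lemma stuck_activated K sigma e : stuck K sigma e.2 \subset activated K sigma e.
Proof.
by rewrite /activated; case: kind_of => [||g||]; rewrite ?stuck_on ?subsetUr.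
Qed.

(** * Effect of moving one job *)

Section Move.
Variables (K : {set M}) (sigma : J -> option M).
Variables (y : J) (i0 i1 : M).
Hypothesis i01 : i1 != i0.
Let sigma' := reassign sigma y i1.

Lemma on_reassign i : on sigma' i =
  if i == i1 then y |: on sigma i else on sigma i :\ y.
Proof.
case: (eqVneq i i1) => ii1; apply/setP => x; rewrite !inE /sigma' /reassign;
  case: (eqVneq x y) => //= _; rewrite (inj_eq Some_inj) eq_sym.
- by rewrite ii1 eqxx.
- exact: negPf.
Qed.

(** On arrival at [i1] the job [y] is not stuck, because [i0] is a permitted machine outside
    [i1 |: K]. *)
Lemma stuck_reassign i : i0 \in Gamma y -> i0 \notin K ->
  (y \notin stuck K sigma i) -> stuck K sigma' i = stuck K sigma i.
Proof.
move=> i0G i0K yS; apply/setP => x; rewrite [LHS]inE [RHS]inE on_reassign.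
have [->|xy] := eqVneq x y; last by case: ifP; rewrite !inE ?(negPf xy).
move: yS; rewrite inE => /negPf->.
case: ifP => [/eqP->|_]; last by rewrite !inE eqxx.
rewrite !inE eqxx /=; case: (boolP (small y)) => //= _.
by apply/negP => /subsetP/(_ _ i0G); rewrite !inE (negPf i0K) orbF eq_sym (negPf i01).
Qed.

Lemma big_reassign i : big sigma' i =
  if small y then big sigma i
  else if i == i1 then y |: big sigma i else big sigma i :\ y.
Proof.
apply/setP => x; rewrite inE on_reassign.
case: (eqVneq x y) => [->|xy]; case: ifP => ii1; case: ifP => sy;
  by rewrite !inE ?eqxx ?(negPf xy) ?ii1 ?sy /= ?andbF.
Qed.

End Move.

(* Applied to blockers older than the one that activated [y]: [y] could still
   return to [i0], so its arrival on [e.2] creates no stuck job. *)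
Lemma reassign_stable K sigma e y i0 i1 : sigma y = Some i0 -> i1 != i0 ->
  i0 \in Gamma y -> i0 \notin K -> y \notin activated K sigma e ->
  (i1 = e.2 -> ~~ closes K sigma e y) ->
  let sigma' := reassign sigma y i1 in
  [/\ kind_of K sigma' e = kind_of K sigma e,
      activated K sigma' e = activated K sigma e,
      closes K sigma' e =1 closes K sigma e
    & value K sigma' e = value K sigma e].
Proof.
move=> y_i0 i01 i0G i0K yact ycl sigma'.
have yS : y \notin stuck K sigma e.2.
  by apply: contra yact; apply/subsetP/stuck_activated.
have SE := @stuck_reassign K sigma y i0 i1 i01 e.2 i0G i0K yS.
(* With the stuck jobs unchanged, everything is determined by the kind and, for [Small], [Pending]
   and [All], by one further set. *)
suff H : kind_of K sigma' e = kind_of K sigma e /\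
  match kind_of K sigma e with
  | Small | Pending => on sigma' e.2 = on sigma e.2
  | All => big sigma' e.2 = big sigma e.2
  | _ => True end.
  case: H => kE H; rewrite /activated /closes /value kE SE; split => //.
  - by move: H; case: kind_of => // ->.
  - by move: H; case: kind_of => // ->.
move: yact ycl (@kind_leastE K sigma e); rewrite /activated /closes.
case: e yS SE => j i /= yS SE; rewrite !SE.
have onE : on sigma' i = on sigma i -> big sigma' i = big sigma i.
  by rewrite /big => ->.
have bigE : big sigma' i = big sigma i -> least sigma' i = least sigma i.
  by rewrite /least => ->.
have stay : y \notin on sigma i -> i1 <> i -> on sigma' i = on sigma i.
  move=> yon i1i; rewrite on_reassign ifN; last by apply/eqP => /esym.
  by apply/setP => x; rewrite !inE; case: eqP => // ->; move: yon; rewrite inE => /negPf->.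
case: (boolP (small j)) => [_ yact ycl _|_].
  by split => //; apply: stay => // /ycl.
case: (boolP (T + q < wt (stuck K sigma i) + p j)) => // tight.
case: (boolP (T + q < wt (stuck K sigma i) + wt (big sigma i) + p j)) => All_i.
  have keep : (y \notin big sigma i :|: stuck K sigma i) ->
      (i1 = i -> ~~ ~~ small y) -> big sigma' i = big sigma i.
    rewrite inE (negPf yS) orbF big_reassign => yB ysm.
    case: ifP => // ysm'; case: eqP => [i1i|_].
      by move/esym: i1i => /ysm; rewrite ysm'.
    by apply/setP => x; rewrite !inE; case: eqP => // ->; move: yB; rewrite !inE => /negPf->.
  case lE: (least sigma i) => [g|]; last first.
    move=> yact ycl _; have B := keep yact ycl; by rewrite bigE // lE B All_i.
  case: ifP => [ltg|nltg]; last first.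
    by move=> yact ycl _; have B := keep yact ycl; rewrite bigE // lE B All_i nltg.
  rewrite inE (negPf yS) orbF inE => yg ycl _.
  (* The job [g] stays least: it is activated, hence differs from [y], and a big [y] arriving on [i]
     is not closed out, so its rank exceeds that of [g]. *)
  have /eqP/leastP[gB g_min] := lE.
  suff -> : least sigma' i = Some g by rewrite ltg.
  apply/eqP/leastP; rewrite big_reassign.
  case: ifP => // ysm; case: eqP => [i1i|_].
    move/esym: i1i => /ycl; rewrite ysm /= negb_or -ltnNge => /andP[_ lt_gy].
    split; first by rewrite inE gB orbT.
    by move=> h /setU1P[->|/g_min //]; exact: ltnW.
  split; first by rewrite !inE eq_sym yg; move: gB; rewrite !inE.
  by move=> h /setD1P[_ /g_min].
case lE: (least sigma i) => [g|]; last first.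
  move=> yact ycl _; have B : on sigma' i = on sigma i by apply: stay => // /ycl.
  by rewrite bigE ?onE // lE (negPf All_i).
have /eqP/leastP[gB g_min] := lE.
have nltg : (T + q < wt (stuck K sigma i) + p g + p j) = false.
  by apply: contraNF All_i => /lt_le_trans; apply; rewrite lerD2r lerD2l wt_mem.
rewrite nltg => yact ycl _; have B : on sigma' i = on sigma i by apply: stay => // /ycl.
by rewrite bigE ?onE // lE (negPf All_i) nltg.
Qed.

Lemma reassign_improves K sigma e y i1 : i1 != e.2 ->
  y \in activated K sigma e ->
  (value K sigma e < value K (reassign sigma y i1) e)%N.
Proof.
case: e => j i /= i1i yact; set sigma' := reassign sigma y i1.
have yon : y \in on sigma i by apply: (subsetP (activated_on K sigma (j, i))).
have onE : on sigma' i = on sigma i :\ y.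
  by rewrite on_reassign ifN // eq_sym.
have SE : stuck K sigma' i = stuck K sigma i :\ y.
  by apply/setP => x; rewrite inE onE !inE; case: eqP.
have BE : big sigma' i = big sigma i :\ y.
  by apply/setP => x; rewrite inE onE !inE; case: eqP.
have con := cardsD1 y (on sigma i); rewrite yon -onE add1n in con.
have len := card_le (on sigma i).
have cS := subset_leq_card (stuck_on K sigma i).
have cB := subset_leq_card (big_on sigma i).
case: (boolP (small j)) => [sj|bj].
  by rewrite /value /= sj; lia.
(* Whatever the kind, the value lies in a block of length [3(n + 1)] fixed by the number of stuck
   jobs. Losing a stuck job therefore moves it to a higher block. *)
have upper : (value K sigma (j, i) <
    (n - #|stuck K sigma i|).+1 * (n.+1 * 3))%N.
  rewrite mulSn /value; case kE: kind_of => [||g||] /=; try lia.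
  by have := rho_lt g; lia.
have lower : ((n - #|stuck K sigma' i|) * (n.+1 * 3) <= value K sigma' (j, i))%N.
  rewrite /value; case kE: kind_of => [||g||] /=; try lia.
  by have := kind_smallE _ _ _ kE; rewrite (negPf bj).
have [yS|yS] := boolP (y \in stuck K sigma i).
  apply: leq_trans upper (leq_trans _ lower); rewrite leq_mul2r; apply/orP; right.
  have := cardsD1 y (stuck K sigma i); rewrite yS -SE add1n; lia.
have {upper lower}SE : stuck K sigma' i = stuck K sigma i.
  by rewrite SE; apply/setDidPl; rewrite disjoint_sym disjoints1.
have lton : (n - #|on sigma i| < n - #|on sigma' i|)%N.
  by rewrite ltn_subS // con.
move: yact; rewrite /activated /value /= (negPf bj) SE.
case: (boolP (T + q < wt (stuck K sigma i) + p j)) => tight; first by rewrite (negPf yS).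
have Bsub : wt (big sigma' i) <= wt (big sigma i) by rewrite BE wt_subset // subD1set.
have minE g : least sigma i = Some g -> forall g', least sigma' i = Some g' ->
    (rho g <= rho g')%N.
  move=> /eqP/leastP[gB g_min] g' /eqP/leastP[]; rewrite BE => /setD1P[_ g'B] _.
  exact: g_min.
have cB' : y \in big sigma i -> (#|big sigma' i| < #|big sigma i|)%N.
  by move=> yB; rewrite (cardsD1 y (big sigma i)) yB BE add1n.
case lE: (least sigma i) => [g|]; last first.
  have B0 := least_none _ _ lE.
  have B0' : big sigma' i = set0.
    by rewrite BE B0; apply/setP => x; rewrite !inE andbF.
  have -> : least sigma' i = None.
    by rewrite /least; case: pickP => // x; rewrite B0' inE.
  rewrite B0 B0' /wt big_set0 addr0 (negPf tight) => _.
  by rewrite !ltn_add2l lton.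
have /eqP/leastP[gB g_min] := lE.
(* Kind [Least g]: the leaving job is [g]. The next big job is no lighter, so it keeps [j] out too
   and has a larger rank; if there is none, the kind becomes [Pending]. *)
have [ltg|nltg] := boolP (T + q < wt (stuck K sigma i) + p g + p j).
  rewrite inE (negPf yS) orbF inE => /eqP yg.
  case lE': (least sigma' i) => [g'|].
    have le_gg' := minE _ lE _ lE'.
    have -> : T + q < wt (stuck K sigma i) + p g' + p j.
      by apply: lt_le_trans ltg _; rewrite lerD2r lerD2l rho_le.
    have : rho g != rho g'.
      apply: contraTneq isT => /rho_inj gg'; move/eqP/leastP: lE' => [].
      by rewrite BE -gg' yg !inE eqxx.
    by rewrite !ltn_add2l ltn_neqAle le_gg' andbT.
  rewrite (least_none _ _ lE') /wt big_set0 addr0 (negPf tight) ltn_add2l.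
  exact: stage_least_pending.
have [all|pend] := boolP (T + q < wt (stuck K sigma i) + wt (big sigma i) + p j).
  rewrite inE (negPf yS) orbF => yB; have := cB' yB => ltB.
  case lE': (least sigma' i) => [g'|]; [case: ifP => _|];
    do ?case: ifP => _; rewrite ltn_add2l;
    by rewrite ?stage_all_least ?stage_all_pending ?ltn_subS.
move=> _.
(* Big weight only decreases, so [Pending] persists and the number of jobs on [i] decides. *)
have pend' : (T + q < wt (stuck K sigma i) + wt (big sigma' i) + p j) = false.
  by apply: contraNF pend => /lt_le_trans; apply; rewrite lerD2r lerD2l.
rewrite pend'; case lE': (least sigma' i) => [g'|]; last first.
  by rewrite !ltn_add2l lton.
rewrite ifN; first by rewrite !ltn_add2l lton.
apply: contraFN pend' => /lt_le_trans; apply; rewrite lerD2r lerD2l wt_mem //.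
by have /eqP/leastP[] := lE'.
Qed.


(** * Lists of blockers and the states they produce *)

Record state := State {
  fullm : {set M}; active : {set J}; blocked : {set J * M}; pending : bool }.

Definition step sigma s e : state :=
  let K := fullm s in
  let k := kind_of K sigma e in
  State (if full k then e.2 |: K else K)
    (active s :|: activated K sigma e)
    (blocked s :|: [set z | (z.2 == e.2) && closes K sigma e z.1])
    (if k is Pending then true else false).

(* A [Pending] machine may fall short of its budget [T] by [T - q]; the small
   blocker that must come next makes up for it (see [legit_small]). *)
Definition admissible sigma s e :=
  [&& e.1 \in active s, e \notin blocked s, e.2 \in Gamma e.1,
      sigma e.1 != Some e.2 & pending s ==> small e.1].

(** States are recomputed from the schedule, so the same list can be replayed after a job has
    moved. *)
Fixpoint run sigma s L :=
  if L is e :: L' then run sigma (step sigma s e) L' else s.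

Fixpoint wf sigma s L :=
  if L is e :: L' then admissible sigma s e && wf sigma (step sigma s e) L'
  else true.

Fixpoint values sigma s L : seq nat :=
  if L is e :: L' then
    value (fullm s) sigma e :: values sigma (step sigma s e) L'
  else [::].

Lemma wf_cat sigma s L1 L2 :
  wf sigma s (L1 ++ L2) = wf sigma s L1 && wf sigma (run sigma s L1) L2.
Proof. by elim: L1 s => //= e L1 IH s; rewrite IH andbA. Qed.

Lemma values_le sigma s L : all (leq^~ max_value) (values sigma s L).
Proof. by elim: L s => //= e L IH s; rewrite value_le IH. Qed.

Lemma size_values sigma s L : size (values sigma s L) = size L.
Proof. by elim: L s => //= e L IH s; rewrite IH. Qed.

Lemma active_run sigma s L : active s \subset active (run sigma s L).
Proof.
elim: L s => //= e L IH s; apply: subset_trans (IH _); exact: subsetUl.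
Qed.

Lemma blocked_run sigma s L : blocked s \subset blocked (run sigma s L).
Proof.
elim: L s => //= e L IH s; apply: subset_trans (IH _); exact: subsetUl.
Qed.

Lemma closes_self K sigma e : closes K sigma e e.1.
Proof.
rewrite /closes; have kS := @kind_smallE K sigma e.
case: e kS => j i /=; case: (boolP (small j)) => //= sj _.
case: ifP => _; first by rewrite lexx.
by case: least => [g|]; [case: ifP => _; rewrite ?lexx //|]; case: ifP.
Qed.

(** Each blocker is a fresh pair that closes itself out. This bounds the length of a list by the
    number of pairs, hence the digits a code needs. *)
Lemma wf_size sigma s L : wf sigma s L ->
  (#|blocked s| + size L <= #|blocked (run sigma s L)|)%N.
Proof.
elim: L s => [|e L IH] s /=; first by rewrite addn0.
case/andP=> /and5P[_ eB _ _ _] /IH; apply: leq_trans.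
rewrite addnS -addSn leq_add2r; apply: proper_card.
apply/properP; split; first exact: subsetUl.
by exists e => //; rewrite !inE eqxx closes_self orbT.
Qed.

Lemma active_assigned sigma s L y :
  y \in active (run sigma s L) -> y \in active s \/ sigma y != None.
Proof.
elim: L s => [|e L IH] s /=; first by left.
case/IH; last by right.
rewrite inE => /orP[]; first by left.
by move/(subsetP (activated_on _ _ _)); rewrite inE => /eqP->; right.
Qed.

(** Follow [L] to the first blocker that activates [y] and cut there. Its value grows by
    [reassign_improves], and the earlier values persist by [reassign_stable]; [L2] is the discarded
    tail. *)
Lemma advance sigma y i0 i1 s L :
    sigma y = Some i0 -> i1 != i0 -> i0 \in Gamma y -> i0 \notin fullm s ->
    y \notin active s -> y \in active (run sigma s L) ->
    (y, i1) \notin blocked (run sigma s L) -> wf sigma s L ->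
  exists L', wf (reassign sigma y i1) s L' /\
    forall L2, lex_lt (values sigma s (L ++ L2)) (values (reassign sigma y i1) s L').
Proof.
move=> y_i0 i01 i0G; elim: L s => [|e L IH] s /= i0K yA; first by rewrite (negPf yA).
move=> yA' yB /andP[adm wfL].
have adm' : admissible (reassign sigma y i1) s e.
  (* Blockers before the activation of [y] concern other jobs, which stay in place. *)
  have ey : e.1 != y by apply: contraNneq yA => <-; case/andP: adm.
  by rewrite /admissible /reassign (negPf ey).
case: (boolP (y \in activated (fullm s) sigma e)) => yact.
  have ei0 : e.2 = i0.
    move/(subsetP (activated_on _ _ _)): yact; rewrite inE y_i0.
    by rewrite (inj_eq Some_inj) => /eqP.
  exists [:: e]; split; first by rewrite /= adm'.
  by move=> L2 /=; rewrite reassign_improves // ei0.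
have ncl : i1 = e.2 -> ~~ closes (fullm s) sigma e y.
  move=> i1e; apply: contra yB => cl.
  by apply: (subsetP (blocked_run _ _ _)); rewrite !inE /= i1e eqxx cl orbT.
have [kE aE cE vE] := reassign_stable _ _ _ _ _ _ y_i0 i01 i0G i0K yact ncl.
have sE : step (reassign sigma y i1) s e = step sigma s e.
  rewrite /step kE aE; congr State; congr (_ :|: _).
  by apply/setP => z; rewrite !inE cE.
have [||L' [wfL' lt_L']] := IH (step sigma s e) _ _ yA' yB wfL.
(* Had this blocker fully closed [i0], it would have activated every job there, [y] included. *)
- rewrite /=; case: ifP => // fk; rewrite !inE negb_or i0K andbT.
  apply: contra yact => /eqP i0e; move: fk; rewrite /activated.
  by case: kind_of => // _; rewrite inE y_i0 i0e.
- by rewrite !inE negb_or yA.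
exists (e :: L'); rewrite /= adm' sE vE; split => // L2.
by rewrite eqxx lt_L' orbT.
Qed.

(** * Termination of the search *)

Definition valid sigma :=
  (forall x i, sigma x = Some i -> i \in Gamma x) /\
  (forall i, wt (on sigma i) <= T + q).

Lemma wt_setU X Y : wt (X :|: Y) <= wt X + wt Y.
Proof.
rewrite {1}/wt (big_setID X) /= (setIidPr (subsetUl X Y)) lerD2l.
by apply: wt_subset; rewrite setDUl setDv set0U subsetDl.
Qed.

Lemma valid_reassign sigma y i : valid sigma -> i \in Gamma y ->
  wt (on sigma i) + p y <= T + q -> valid (reassign sigma y i).
Proof.
case=> adm load iG le_i; split=> [x k|k].
  by rewrite /reassign; case: eqP => [-> [<-]|_ /adm].
rewrite on_reassign; case: eqP => [->|_]; first last.
    by apply: le_trans (load k); rewrite wt_subset // subD1set.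
  apply: le_trans (wt_setU _ _) _; rewrite addrC; apply: le_trans le_i.
  by rewrite {2}/wt big_set1.
Qed.

Definition start j0 := State set0 [set j0] set0 false.

Definition legit sigma e := T + q < wt (on sigma e.2) + p e.1.

Lemma lex_lt_cat s t : t != [::] -> lex_lt s (s ++ t).
Proof.
by elim: s => [|a s IH] /=; [case: t | move/IH ->; rewrite eqxx orbT].
Qed.

Lemma values_cat sigma s L1 L2 :
  values sigma s (L1 ++ L2) = values sigma s L1 ++ values sigma (run sigma s L1) L2.
Proof. by elim: L1 s => //= e L1 IH s; rewrite IH. Qed.

Section Extend.
Variable j0 : J.

Hypothesis never_stuck : forall sigma L, valid sigma -> sigma j0 = None ->
  wf sigma (start j0) L -> all (legit sigma) L ->
  exists e, admissible sigma (run sigma (start j0) L) e.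

Lemma extend sigma : valid sigma -> sigma j0 = None ->
  exists2 sigma', valid sigma' &
    forall x, (x == j0) || (sigma x != None) -> sigma' x != None.
Proof.
set s0 := start j0; set N := #|{: J * M}|; set V := max_value.
pose code sigma L := lex_code V N (values sigma s0 L).
(* Induction on the distance of the code from its upper bound. *)
suff: forall m sigma L, (V.+2 ^ N - code sigma L <= m)%N ->
    valid sigma -> sigma j0 = None -> wf sigma s0 L ->
  exists2 sigma', valid sigma' &
    forall x, (x == j0) || (sigma x != None) -> sigma' x != None.
  by move=> H v0 n0; apply: (H _ sigma [::] (leqnn _)).
have code_lt sig L : (code sig L < V.+2 ^ N)%N by rewrite lex_code_lt ?values_le.
have better sig L sig' L' : wf sig' s0 L' ->
    lex_lt (values sig s0 L) (values sig' s0 L') -> (code sig L < code sig' L')%N.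
  move=> wf' /lex_code_mono; apply; rewrite ?values_le // size_values.
  by have := wf_size _ _ _ wf'; rewrite cards0 => /leq_trans; apply; exact: max_card.
elim=> [|m IH] {}sigma L.
  by rewrite leqn0 subn_eq0 leqNgt code_lt.
move=> le_m val_s nj0 wfL.
have next sig' L' : valid sig' -> sig' j0 = None -> wf sig' s0 L' ->
    (code sigma L < code sig' L')%N -> (forall x, sigma x != None -> sig' x != None) ->
    exists2 sigma', valid sigma' &
      forall x, (x == j0) || (sigma x != None) -> sigma' x != None.
  move=> val' nj0' wf' lt_code dom.
  have [|sig'' val'' dom''] := IH sig' L' _ val' nj0' wf'.
    by have := code_lt sig' L'; lia.
  exists sig'' => // x /orP[xj0|/dom xdom]; apply: dom''; first by rewrite xj0.
  by rewrite xdom orbT.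
have [all_legit|] := boolP (all (legit sigma) L).
  have [e adm] := never_stuck _ _ val_s nj0 wfL all_legit.
  have wf' : wf sigma s0 (L ++ [:: e]) by rewrite wf_cat wfL /= adm.
  by apply: (next _ _ val_s nj0 wf') => //; rewrite better // values_cat lex_lt_cat.
(* The blocker [(y, i1)] has room. After the prefix [L1], [y] is active and [(y, i1)] is not yet
   blocked, as [advance] requires. *)
case/allPn=> -[y i1] /splitPr eL; case: eL wfL next {le_m} => L1 L2.
rewrite wf_cat => /andP[wf1 /= /andP[/and5P[/= yA yB i1G yi1 _] _]] next.
rewrite /legit -leNgt /= => le_i1.
have val' := valid_reassign _ _ _ val_s i1G le_i1.
have [yj0|yj0] := eqVneq y j0.
  exists (reassign sigma y i1) => // x; rewrite /reassign.
  by case: (eqVneq x y) => //; rewrite yj0 => /negPf->.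
have yA0 : y \notin active s0 by rewrite inE.
have := active_assigned _ _ _ _ yA; rewrite (negPf yA0) => -[//|].
case y_i0 : (sigma y) => [i0|//] _.
have i01 : i1 != i0 by apply: contraNneq yi1 => ->; rewrite y_i0.
have i0G := val_s.1 _ _ y_i0.
have i0K : i0 \notin fullm s0 by rewrite inE.
have [L' [wf' lt_L']] := advance _ _ _ _ _ _ y_i0 i01 i0G i0K yA0 yA yB wf1.
apply: (next _ L' val') => //.
- by rewrite /reassign eq_sym (negPf yj0) nj0.
- exact: better.
- by move=> x; rewrite /reassign; case: (x == y).
Qed.

End Extend.

(** * Dual values and what truncation costs *)

Hypothesis p_le_T : forall x, p x <= T.
Hypothesis q_ge : T *+ 5 <= q *+ 6.
Hypothesis q_le : q <= T.

(* Truncating the sizes at [q] gives the job values of a dual solution of the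
   configuration LP. *)
Definition z x : R := Num.min (p x) q.
Definition zw X : R := \sum_(x in X) z x.

Lemma bounds : [/\ 0 <= T, T *+ 5 <= q *+ 6, q <= T & 0 <= q].
Proof.
split => //; first by have := q_ge; have := q_le; lra.
by have := q_ge; have := q_le; lra.
Qed.

Lemma z_ge0 x : 0 <= z x.
Proof. by rewrite le_min p_ge0; have [] := bounds. Qed.

Lemma z_le x : z x <= p x.
Proof. by rewrite ge_min lexx. Qed.

Lemma z_le_q x : z x <= q.
Proof. by rewrite ge_min lexx orbT. Qed.

Lemma z_p x : p x <= q -> z x = p x.
Proof. exact: min_l. Qed.

Lemma z_q x : q <= p x -> z x = q.
Proof. exact: min_r. Qed.

Lemma z_mono x y : p x <= p y -> z x <= z y.
Proof. by move=> xy; rewrite le_min z_le_q (le_trans (z_le x) xy). Qed.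

Lemma zw_subset X Y : X \subset Y -> zw X <= zw Y.
Proof.
move=> sXY; rewrite /zw [leRHS](big_setID X) /= (setIidPr sXY) lerDl.
by apply: sumr_ge0 => x _; exact: z_ge0.
Qed.

Lemma zw_le X : zw X <= wt X.
Proof. by apply: ler_sum => x _; exact: z_le. Qed.

Lemma zw_wt X : (forall x, x \in X -> p x <= q) -> zw X = wt X.
Proof. by move=> le_q; apply: eq_bigr => x /le_q /z_p. Qed.

Lemma zwU1 x X : x \notin X -> zw (x |: X) = z x + zw X.
Proof. by move=> xX; rewrite /zw big_setU1. Qed.

Lemma zwD1 x X : x \in X -> zw X = z x + zw (X :\ x).
Proof. by move=> xX; rewrite /zw (big_setD1 x). Qed.

Lemma wtD1 x X : x \in X -> wt X = p x + wt (X :\ x).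
Proof. by move=> xX; rewrite /wt (big_setD1 x). Qed.

Lemma zw_mem X x : x \in X -> z x <= zw X.
Proof.
move=> xX; rewrite (zwD1 _ _ xX) lerDl.
by apply: sumr_ge0 => y _; exact: z_ge0.
Qed.

Lemma small_le_q x : small x -> p x <= q.
Proof. by rewrite /small; have [? ? ? ?] := bounds; lra. Qed.

Lemma big_z x : ~~ small x -> T <= z x *+ 2.
Proof.
rewrite -ltNge /z => bx; have [? ? ? ?] := bounds.
by case: (leP (p x) q) => _; lra.
Qed.

(** The cases are no job above [q], at least two, and exactly one; a single one loses at most
    [T - q]. *)
Lemma zw_lower X :
  zw X = wt X \/ (q <= zw X /\ (q *+ 2 <= zw X \/ wt X - (T - q) <= zw X)).
Proof.
have [/exists_inP[x xX qx]|] := boolP [exists x in X, q < p x]; last first.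
  rewrite negb_exists_in => /forall_inP le_q; left; apply: zw_wt => x /le_q.
  by rewrite -leNgt.
have zx := z_q _ (ltW qx); right; rewrite (zwD1 _ _ xX) (wtD1 _ _ xX) zx; split.
  by rewrite lerDl; apply: sumr_ge0 => y _; exact: z_ge0.
have [/exists_inP[y yX qy]|] := boolP [exists y in X :\ x, q < p y].
  by left; rewrite mulr2n lerD2l -(z_q _ (ltW qy)) zw_mem.
rewrite negb_exists_in => /forall_inP le_q; right.
rewrite zw_wt; last by move=> y /le_q; rewrite -leNgt.
by have := p_le_T x; lra.
Qed.

(** The bound [q >= 5T/6] originates here. The jobs on the machine weigh more than [q + T/2]; if
    exactly one exceeds [q], truncation leaves more than [2q - T/2], which must reach [2T - q]. *)
Lemma legit_small sigma e : legit sigma e -> small e.1 ->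
  T - zw (on sigma e.2) <= - (T - q).
Proof.
rewrite /legit /small => ov sm; have [? ? ? ?] := bounds.
by have [->|[_ []]] := zw_lower (on sigma e.2); lra.
Qed.

Lemma legit_any sigma e : legit sigma e -> T - zw (on sigma e.2) <= T - q.
Proof.
rewrite /legit => ov; have [? ? ? ?] := bounds; have := p_le_T e.1.
by have [->|[? _]] := zw_lower (on sigma e.2); lra.
Qed.

(* [Y] pays for a big job [x] entering a machine whose active jobs include
   [Y], whatever small active jobs [D] of that machine accompany [x] in a
   configuration. *)
Definition pays Y x := forall D : {set J},
  (forall d, d \in D -> small d) -> wt D + p x <= T ->
  z x + zw D <= zw (Y :|: D).

Lemma pays_big (g x : J) Y : g \in Y -> ~~ small g -> z x <= z g -> pays Y x.
Proof.
move=> gY bg xg D smD _.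
have gD : g \notin D by apply: contra bg => /smD.
apply: (@le_trans _ _ (zw (g |: D))); first by rewrite zwU1 // lerD2r.
by apply: zw_subset; rewrite setSU // sub1set.
Qed.

(** Since [D] weighs at most [T - p x], the jobs of [X] outweigh [D] by more than [q], and they lose
    nothing to truncation. *)
Lemma pays_weight (X Y : {set J}) x : X \subset Y -> (forall d, d \in X -> p d <= q) ->
  T + q < wt X + p x -> pays Y x.
Proof.
move=> sXY le_q ov D _ leD.
apply: (@le_trans _ _ (zw X)); last by apply: zw_subset; rewrite (subset_trans sXY) ?subsetUl.
by rewrite (zw_wt _ le_q); have := zw_le D; have := z_le_q x; lra.
Qed.

(** Two big jobs have truncated value at least [T], hence at least [q]. *)
Lemma pays_pair (g h x : J) Y : g \in Y -> h \in Y -> g != h ->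
  ~~ small g -> ~~ small h -> pays Y x.
Proof.
move=> gY hY gh bg bh D smD _.
have hD : h \notin D by apply: contra bh => /smD.
have gD : g \notin h |: D by rewrite !inE negb_or gh; apply: contra bg => /smD.
apply: (@le_trans _ _ (zw (g |: (h |: D)))); last first.
  apply: zw_subset; rewrite setUA setSU //.
  by apply/subsetP => y; rewrite !inE => /orP[] /eqP->.
rewrite !zwU1 //; have := big_z _ bg; have := big_z _ bh.
have := z_le_q x; have [? ? ? ?] := bounds; lra.
Qed.

(** * Closed pairs are paid for; the invariant of the search *)

Lemma stuck_small K sigma i x : x \in stuck K sigma i -> small x.
Proof. by rewrite inE => /and3P[]. Qed.

Lemma closes_pays K sigma e x : ~~ full (kind_of K sigma e) ->
  closes K sigma e x -> ~~ small x /\ pays (activated K sigma e) x.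
Proof.
have stuck_q d : d \in stuck K sigma e.2 -> p d <= q.
  by move/stuck_small/small_le_q.
have kL := @kind_leastE K sigma e.
case: e stuck_q kL => j i stuck_q kL; rewrite /closes /activated.
case kE: kind_of => [||g||] //= _; rewrite /= in stuck_q kL kE.
- case/andP=> bx le_jx; split => //; apply: (@pays_weight (stuck K sigma i)) => //.
  move: kE; case: ifP => // _; case: ifP => [tight _|_]; first by lra.
  by case: least => [h|]; [case: ifP => // _|]; case: ifP.
- have [lE _ ov] := kL _ kE; have /eqP/leastP[gB _] := lE.
  have bg : ~~ small g by move: gB; rewrite inE => /andP[].
  have gS : g \notin stuck K sigma i by apply: contra bg => /stuck_small.
  case/andP=> bx le_x; split => //.
  (* Either [g] alone pays for [x], or [z g < z x]. Then [x] is closed because of its size, and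
     [p g <= q], so the untruncated weight of [g] and the stuck jobs pays. *)
  have [xg|gx] := leP (z x) (z g); first by apply: (@pays_big g); rewrite // setU11.
  have le_jx : p j <= p x.
    by case/orP: le_x => // /rho_le /z_mono; rewrite leNgt gx.
  apply: (@pays_weight (g |: stuck K sigma i)) => // [d|]; last first.
    by rewrite /wt big_setU1 //= -/(wt _); lra.
  case/setU1P => [->|/stuck_q //]; rewrite leNgt; apply/negP => /ltW/z_q zg.
  by move: gx; rewrite zg ltNge z_le_q.
- move=> bx; split => //.
  (* The least big job alone does not keep [j] out but all big jobs do, so there are at least
     two. *)
  have [g [h [gB hB gh]]] : exists g h, [/\ g \in big sigma i, h \in big sigma i & g != h].
    move: kE; case: ifP => // _; case: ifP => // tight.
    case lE: least => [g|]; last first.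
      by rewrite (least_none _ _ lE) {2}/wt big_set0 addr0 tight.
    case: ifP => // ng; case: ifP => // ov _; exists g.
    have /eqP/leastP[gB _] := lE.
    have [h hB] : exists h, h \in big sigma i :\ g.
      apply/set0Pn; apply: contraFneq ng => B0; move: ov.
      by rewrite (wtD1 _ _ gB) B0 {2}/wt big_set0 addr0.
    by exists h; case/setD1P: hB => hg hB; split=> //; rewrite eq_sym.
  move: (gB) (hB); rewrite !inE => /andP[_ bg] /andP[_ bh].
  by apply: (@pays_pair g h) => //; rewrite inE ?gB ?hB.
Qed.

(** [inv_margin] says that the truncated values on the fully closed machines cover their budgets
    [T], up to one shortfall [T - q] while pending. [inv_pending] supplies a small job with a
    machine to try, so the search cannot end with that shortfall. *)
Record invariant sigma s : Prop := Invariant {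
  inv_margin : \sum_(i in fullm s) (T - zw (on sigma i)) <=
               if pending s then T - q else 0;
  inv_full : forall i, i \in fullm s -> on sigma i \subset active s;
  inv_fullB : forall i x, i \in fullm s -> (x, i) \in blocked s;
  inv_pays : forall x i, (x, i) \in blocked s -> i \notin fullm s ->
    ~~ small x /\ exists2 Y : {set J}, Y \subset active s :&: on sigma i & pays Y x;
  inv_pending : pending s -> exists x i,
    [/\ x \in active s, small x, i \in Gamma x, sigma x != Some i & i \notin fullm s] }.

Lemma invariant_start sigma j0 : invariant sigma (start j0).
Proof.
split => //= [|i|i x|x i]; rewrite ?inE //.
by rewrite big_set0.
Qed.

(** All jobs on the machine keep [j] out, but the stuck and big ones do not. So some small job there
    is not stuck and has another machine outside [K]. *)
Lemma pending_witness K sigma e : legit sigma e -> kind_of K sigma e = Pending ->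
  exists x i, [/\ x \in on sigma e.2, small x, i \in Gamma x, i != e.2 & i \notin K].
Proof.
case: e => j i; rewrite /legit /= => ov.
case: ifP => // _; case: ifP => // _ kE.
have {}kE : wt (stuck K sigma i) + wt (big sigma i) + p j <= T + q.
  rewrite leNgt; apply/negP => ov'; move: kE.
  by rewrite ov'; case: least => [g|] //; case: ifP.
have [x xon xSB] : exists2 x, x \in on sigma i & x \notin stuck K sigma i :|: big sigma i.
  apply/subsetPn; apply/negP => /wt_subset.
  by have := wt_setU (stuck K sigma i) (big sigma i); lra.
have x_i : sigma x == Some i by move: xon; rewrite inE.
move: xSB; rewrite !inE x_i negb_or negbK /=.
case: (boolP (small x)) => [sx /=|_]; last by rewrite andbF.
rewrite andbT => /subsetPn[k kG]; rewrite !inE negb_or => /andP[ki kK].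
by exists x, k.
Qed.

Lemma invariant_step sigma s e : invariant sigma s -> admissible sigma s e ->
  legit sigma e -> invariant sigma (step sigma s e).
Proof.
case=> margin fullA fullB paysB pend /and5P[eA eB eG es e_pend] ov.
have eK : e.2 \notin fullm s.
  by apply: contra eB => /(fullB _ e.1); rewrite -surjective_pairing.
split=> /=.
- have [fk|nfk] := boolP (full _); last first.
    have np : pending s = false.
      apply: contraNF nfk => ps; move: e_pend; rewrite ps /=.
      by case: (e) => j i /= ->.
    by move: nfk margin; rewrite np; case: kind_of.
  (* A [Small] blocker brings a surplus of at least [T - q], cancelling any shortfall. A [Pending]
     one costs at most [T - q] and occurs only when none is outstanding. *)
  rewrite big_setU1 //=; move: fk e_pend; case kE: kind_of => // _.
    have := legit_small _ _ ov (kind_smallE _ _ _ kE).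
    by move: margin; have [? ? ? ?] := bounds; case: ifP => _; lra.
  case: (pending s) margin => /= margin e_pend; last by have := legit_any _ _ ov; lra.
  by move: kE; case: (e) e_pend => j i /= ->.
- move=> i; case: ifP => fk; last first.
    by move=> /fullA /subset_trans; apply; exact: subsetUl.
  case/setU1P => [->|/fullA /subset_trans]; last by apply; exact: subsetUl.
  apply: subset_trans (subsetUr _ _); rewrite /activated.
  by move: fk; case: kind_of.
- move=> i x; case: ifP => fk; last by move=> iK; rewrite inE fullB.
  case/setU1P => [->|iK]; last by rewrite inE fullB.
  rewrite !inE eqxx /closes /=; apply/orP; right.
  by move: fk; case: kind_of.
- move=> x i; rewrite !inE => /orP[xB|/andP[/= /eqP-> cl]].
    move=> iK; have [|bx [Y sY payY]] := paysB _ _ xB.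
      by apply: contra iK => iK; case: ifP => // _; rewrite inE iK orbT.
    split => //; exists Y => //; apply: subset_trans sY _.
    by rewrite setSI // subsetUl.
  case: ifP => fk; first by rewrite setU11.
  move=> _; have [bx payx] := closes_pays _ _ _ _ (negbT fk) cl.
  split => //; exists (activated (fullm s) sigma e) => //.
  by rewrite subsetI subsetUr activated_on.
- case kE: kind_of => //= _.
  have [x [i [xon sx iG ie iK]]] := pending_witness _ _ _ ov kE.
  exists x, i; split => //.
  + by rewrite inE /activated kE xon orbT.
  + by move: xon; rewrite inE => /eqP->; rewrite (inj_eq Some_inj) eq_sym.
  + by rewrite !inE negb_or ie.
Qed.

Lemma invariant_run sigma s L : invariant sigma s -> wf sigma s L ->
  all (legit sigma) L -> invariant sigma (run sigma s L).
Proof.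
elim: L s => //= e L IH s inv /andP[adm wfL] /andP[ov ovs].
by apply: IH => //; exact: invariant_step.
Qed.

(** * Weak LP duality and the contradiction for a search that stops *)

Lemma configLP_dual (y : M -> R) (w : J -> R) :
    configLP_feasible p Gamma T -> (forall j, 0 <= w j) -> (forall i, 0 <= y i) ->
    (forall i C, is_config p Gamma T i C -> \sum_(j in C) w j <= y i) ->
  \sum_j w j <= \sum_i y i.
Proof.
case=> u [u_ge0 [u_le u_ge]] w_ge0 y_ge0 w_le.
apply: (@le_trans _ _ (\sum_j w j *
    \sum_i \sum_(C | is_config p Gamma T i C && (j \in C)) u i C)).
  by apply: ler_sum => j _; rewrite ler_peMr.
under eq_bigr do rewrite mulr_sumr.
rewrite exchange_big /=; apply: ler_sum => i _.
apply: (@le_trans _ _ (\sum_(C | is_config p Gamma T i C) u i C * y i)); last first.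
  by rewrite -mulr_suml ler_piMl.
under eq_bigr do rewrite mulr_sumr.
rewrite (exchange_big_dep (is_config p Gamma T i)) /=; last by move=> j C _ /andP[].
apply: ler_sum => C confC; rewrite -mulr_suml mulrC ler_wpM2l ?u_ge0 //.
by rewrite (eq_bigl (mem C)) ?w_le // => j; rewrite confC.
Qed.

Lemma not_stuck sigma j0 L :
    configLP_feasible p Gamma T -> 0 < p j0 -> sigma j0 = None ->
    wf sigma (start j0) L -> all (legit sigma) L ->
  exists e, admissible sigma (run sigma (start j0) L) e.
Proof.
move=> feas p_gt0 nj0 wfL ovs; set s := run sigma (start j0) L.
apply/existsP; rewrite -[[exists _, _]]negbK; apply/negP => /existsPn stuck_s.
have [margin fullA fullB paysB pend] : invariant sigma s.
  exact: invariant_run (invariant_start _ _) wfL ovs.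
have closed_s x i : x \in active s -> i \in Gamma x -> sigma x != Some i ->
    (pending s -> small x) -> (x, i) \in blocked s.
  move=> xA iG x_i /implyP xp; apply: contraNT (stuck_s (x, i)) => xB.
  by rewrite /admissible xA xB iG x_i.
(* The small job provided by [inv_pending] would be blocked from a machine that is not fully closed,
   where only big jobs are blocked. *)
have np : pending s = false.
  apply/negP => ps; have [x [i [xA sx iG x_i iK]]] := pend ps.
  have [] := paysB _ _ (closed_s _ _ xA iG x_i (fun _ => sx)) iK.
  by rewrite sx.
rewrite np in margin closed_s.
have {}closed_s x i : x \in active s -> i \in Gamma x -> sigma x != Some i ->
    (x, i) \in blocked s by move=> xA iG x_i; apply: closed_s.
have [T0 _ qT q0] := bounds.
set A := active s in fullA paysB closed_s *.
have j0A : j0 \in A by apply: (subsetP (active_run _ _ _)); rewrite inE.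
pose y i := if i \in fullm s then T else zw (A :&: on sigma i).
pose w x := if x \in A then z x else 0.
have wE (C : {set J}) : \sum_(j in C) w j = zw (A :&: C).
  rewrite /zw /w -big_mkcondr; apply: eq_bigl => x; by rewrite inE andbC.
have zw_ge0 X : 0 <= zw X by apply: sumr_ge0 => x _; exact: z_ge0.
have dual : \sum_j w j <= \sum_i y i.
  apply: configLP_dual => // [j|i|i C /andP[CG CT]].
  - by rewrite /w; case: ifP => // _; exact: z_ge0.
  - by rewrite /y; case: ifP.
  rewrite wE /y; have wtC : wt (A :&: C) <= T.
    by apply: le_trans CT; apply: wt_subset; exact: subsetIr.
  case: ifPn => [_|iK]; first exact: le_trans (zw_le _) wtC.
  have inG x : x \in A :&: C -> i \in Gamma x.
    by rewrite inE => /andP[_ /(subsetP CG)]; rewrite inE.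
  have inA x : x \in A :&: C -> x \in A by rewrite inE => /andP[].
  (* An active job [x] of the configuration that is not on [i] is blocked there, hence big. The
     other active jobs are then small, since the total is at most [T], and they are already on [i],
     so [x] can be paid for. *)
  have [sub|/subsetPn[x xC x_i]] := boolP (A :&: C \subset on sigma i).
    by apply: zw_subset; rewrite subsetI subsetIl.
  have out x' : x' \in A :&: C -> x' \notin on sigma i -> (x', i) \in blocked s.
    move=> x'C x'i; apply: closed_s; rewrite ?inA ?inG //.
    by move: x'i; rewrite inE.
  have [bx [Y sY payY]] := paysB _ _ (out _ xC x_i) iK.
  have smD d : d \in (A :&: C) :\ x -> small d.
    case/setD1P=> dx dC; move: bx wtC; rewrite /small -ltNge (wtD1 _ _ xC) => bx wtC.
    have : p d <= wt ((A :&: C) :\ x) by rewrite wt_mem // !inE dx -in_setI.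
    by rewrite leNgt => le_d; apply/negP => bd; lra.
  rewrite (zwD1 _ _ xC); apply: (@le_trans _ _ (zw (Y :|: (A :&: C) :\ x))).
    by apply: payY => //; rewrite addrC -wtD1.
  apply: zw_subset; rewrite subUset sY; apply/subsetP => d dD.
  have /setD1P[_ dC] := dD; rewrite inE inA //=; apply: contraTT (smD _ dD) => d_i.
  by have [] := paysB _ _ (out _ dC d_i) iK.
(* By the margin, a budget [T] may be replaced by the value of the active jobs on the machine. Each
   active job lies on at most one machine, and [j0] on none. *)
have total : \sum_i y i <= zw (A :\ j0).
  apply: (@le_trans _ _ (\sum_i zw (A :&: on sigma i))).
    rewrite -subr_ge0 -sumrB (bigID (mem (fullm s))) /=.
    rewrite [X in _ + X]big1 ?addr0; last first.
      by move=> i iK; rewrite /y (negPf iK) subrr.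
    rewrite -oppr_le0 -sumrN; apply: le_trans margin; apply: ler_sum => i iK.
    by rewrite /y iK opprB (setIidPr (fullA _ iK)).
  have -> : \sum_i zw (A :&: on sigma i) =
      \sum_i \sum_(x | (x \in A) && (sigma x == Some i)) z x.
    by apply: eq_bigr => i _; apply: eq_bigl => x; rewrite !inE.
  rewrite (exchange_big_dep (mem A)) /=; last by move=> i x _ /andP[].
  rewrite /zw [leLHS](big_setD1 j0) //= [X in X + _]big_pred0 ?add0r; last first.
    by move=> i; rewrite nj0 andbF.
  apply: ler_sum => x /setD1P[_ xA]; case x_i: (sigma x) => [i|].
    by rewrite (big_pred1 i) // => k; rewrite xA (inj_eq Some_inj) eq_sym.
  by rewrite big_pred0 ?z_ge0 // => k; rewrite andbF.
have wA : \sum_j w j = zw A.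
  by rewrite -[in RHS](setIT A) -wE; apply: eq_bigl => x; rewrite inE.
have := le_trans dual total; rewrite wA (zwD1 _ _ j0A) gerDr leNgt => /negP[].
rewrite /z lt_min p_gt0 /=; have := p_le_T j0; have := q_ge; lra.
Qed.

(** * From one more job to a full schedule *)

Lemma valid_extend sigma j0 : configLP_feasible p Gamma T ->
    (forall j, Gamma j != set0) -> valid sigma -> sigma j0 = None ->
  exists2 sigma', valid sigma' &
    forall x, (x == j0) || (sigma x != None) -> sigma' x != None.
Proof.
move=> feas G0 val_s nj0.
have [p_gt0|p_le0] := ltP 0 (p j0).
  by apply: extend => // sig L _ nsig; exact: not_stuck.
(* A job of size zero fits on any permitted machine; the duality argument needs [z j0 > 0]. *)
have /set0Pn[i iG] := G0 j0; exists (reassign sigma j0 i).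
  apply: valid_reassign => //; apply: le_trans (val_s.2 i).
  by rewrite gerDl.
by move=> x; rewrite /reassign; case: eqP.
Qed.

Lemma full_schedule : configLP_feasible p Gamma T -> (forall j, Gamma j != set0) ->
  exists2 sigma, valid sigma & forall x, sigma x != None.
Proof.
move=> feas G0.
suff: forall m sigma, valid sigma -> (#|[set x | sigma x == None]| <= m)%N ->
    exists2 sigma', valid sigma' & forall x, sigma' x != None.
  move/(_ _ (fun=> None)); apply; last exact: leqnn.
  split=> // i; rewrite /wt big1; last by move=> x; rewrite inE.
  by have [? ? ? ?] := bounds; lra.
elim=> [|m IH] sigma val_s.
  rewrite leqn0 cards_eq0 => /eqP U0; exists sigma => // x.
  by have := in_set0 x; rewrite -U0 inE => ->.
have [U0|/set0Pn[j0]] := eqVneq [set x | sigma x == None] set0.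
  by move=> _; apply: (IH sigma) => //; rewrite U0 cards0.
rewrite inE => /eqP nj0 le_m.
have [sig' val' dom] := valid_extend _ _ feas G0 val_s nj0.
apply: (IH sig') => //; rewrite -ltnS; apply: leq_trans le_m.
apply: proper_card; apply/properP; split.
  by apply/subsetP => x; rewrite !inE; apply: contraTT => nx; rewrite dom // nx orbT.
by exists j0; rewrite !inE ?nj0 //; apply: dom; rewrite eqxx.
Qed.

End LocalSearch.

(** A job larger than [T] lies in no configuration, so its covering constraint would read
    [1 <= 0]. *)
Lemma configLP_size_le (R : realFieldType) (J M : finType) (p : J -> R)
    (Gamma : J -> {set M}) (T : R) :
  (forall j, 0 <= p j) -> configLP_feasible p Gamma T -> forall j, p j <= T.
Proof.
move=> hp [u [_ [_ /(_ _)cover]]] j; rewrite leNgt; apply/negP => lt_T.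
have := cover j; rewrite big1 ?ler10 // => i _; rewrite big_pred0 // => C.
apply: contraTF lt_T => /andP[/andP[_ le_T] jC]; rewrite -leNgt.
by apply: le_trans le_T; rewrite (big_setD1 j) //= lerDl sumr_ge0.
Qed.

Theorem theorem3 (R : realFieldType) (J M : finType) (p : J -> R)
    (Gamma : J -> {set M})
    (hp : forall j, 0 <= p j) (hGamma : forall j, Gamma j != set0)
    (T : R) (hT : 0 <= T) (hLP : configLP_feasible p Gamma T) :
  exists sigma : J -> M, is_schedule Gamma sigma /\
    forall i, load p sigma i <= (33%:R / 17%:R) * T.
Proof.
have [rho [rho_inj rho_lt rho_le]] := sorting_rank _ _ p.
(* The choice is admissible because [5/6 <= 16/17 <= 1], and [1 + 16/17 = 33/17]. *)
have [||sigma [adm le_load] total] := @full_schedule R J M p Gamma T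
  ((16%:R / 17%:R) * T) rho #|J| (fun X => max_card (mem X)) hp rho_inj rho_lt rho_le
  (configLP_size_le _ _ _ _ _ _ hp hLP) _ _ hLP hGamma.
- by lra.
- by lra.
have /fin_all_exists[tau tauE] x : exists i, sigma x = Some i.
  by case: (sigma x) (total x) => // i _; exists i.
exists tau; split=> [x|i]; first exact: adm.
apply: (@le_trans _ _ (T + 16%:R / 17%:R * T)); last by lra.
apply: le_trans (le_load i); rewrite /load /wt le_eqVlt; apply/orP; left; apply/eqP.
by apply: eq_bigl => x; rewrite inE tauE (inj_eq Some_inj).
Qed.
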